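(* Let $\mathcal C$ be a locally cartesian closed category, $p:\tilde U\to U$ a universe in $\mathcal C$, $Eq$ a J0-structure on $p$ and $\Omega$ a J1-structure on $p$ over $Eq$. Let $Fp=(I_{p_E}(U),I^{\omega}(U))\times_{I_p(U)}(I_p(\tilde U),I_p(p))$, let $pFp:Fp\to U$ be its projection to $U$ and let $pr_1:Fp\to I_{p_E}(U)$, $pr_2:Fp\to I_p(\tilde U)$ be the projections. Consider the square with top arrow $adj(pr_2)\circ pr_2:(Fp,pFp)\times_U(\tilde U,p)\to \tilde U$ (the second $pr_2$ being the projection $U\times\tilde U\to\tilde U$), bottom arrow $adj(pr_1)\circ pr_2:(Fp,pFp)\times_U(E\tilde U,p_E)\to U$ (here $pr_2$ is the second projection $U\times U\to U$), left arrow $Id_{Fp}\times\omega:(Fp,pFp)\times_U(\tilde U,p)\to(Fp,pFp)\times_U(E\tilde U,p_E)$, and right arrow $p:\tilde U\to U$. Then the rule $Jp\mapsto adj(Jp)\circ pr_2$ (where $adj(Jp):(Fp,pFp)\times_U(E\tilde U,p_E)\to U\times\tilde U$ and $pr_2:U\times\tilde U\to\tilde U$) defines a bijection between the set of J2-structures $Jp$ on $p$ relative to $(Eq,\Omega)$ and the set of morphisms $g:(Fp,pFp)\times_U(E\tilde U,p_E)\to\tilde U$ that split this square into two commutative triangles, i.e. such that $(Id_{Fp}\times\omega)\circ g=adj(pr_2)\circ pr_2$ and $g\circ p=adj(pr_1)\circ pr_2$.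
   Context: Composition is written in diagrammatic order: $f\circ g$ means first $f$, then $g$. Universes. A universe in a category $\mathcal C$ is a morphism $p:\tilde U\to U$ together with, for every object $X$ and every $F:X\to U$, a chosen pull-back square with vertex $(X;F)$ and projections $p_{X,F}:(X;F)\to X$, $Q(F):(X;F)\to\tilde U$ (so $p_{X,F}\circ F=Q(F)\circ p$). For $f:W\to X$, $g:W\to\tilde U$ with $f\circ F=g\circ p$, $f*g:W\to(X;F)$ is the unique morphism with $(f*g)\circ p_{X,F}=f$, $(f*g)\circ Q(F)=g$. J0- and J1-structures. A J0-structure on $p$ is a morphism $Eq:(\tilde U;p)\to U$. Put $E\tilde U:=((\tilde U;p);Eq)$ and $p_E:=p_{(\tilde U;p),Eq}\circ p_{\tilde U,p}\circ p:E\tilde U\to U$. A J1-structure over $Eq$ is a morphism $\Omega:\tilde U\to\tilde U$ with $\Omega\circ p=\Delta\circ Eq$, where $\Delta=Id_{\tilde U}*Id_{\tilde U}:\tilde U\to(\tilde U;p)$. Put $\omega:=\Delta*\Omega:\tilde U\to E\tilde U$; it is a morphism over $U$ from $p$ to $p_E$. Locally cartesian closed categories. Such a category has chosen fiber products $(X,f)\times_Z(Y,g)$, a final object (so products exist) and chosen relative internal Hom-objects $\underline{Hom}_Z((X,f),(Y,g))$ over $Z$, with natural bijections $adj:Hom_Z((W,h),\underline{Hom}_Z((X,f),(Y,g)))\to Hom_Z((W,h)\times_Z(X,f),(Y,g))$ ($Hom_Z$ = morphisms over $Z$). No compatibility is assumed between the chosen fiber products and the universe structure. For a morphism $p:\tilde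 U\to U$ and an object $V$ put $I_p(V):=\underline{Hom}_U((\tilde U,p),(U\times V,pr_1))$, an object over $U$ with structure morphism $prI_p(V):I_p(V)\to U$. For $a:V\to V'$, $I_p(a):I_p(V)\to I_p(V')$ is induced by $Id_U\times a$ (post-composition). For $h:\tilde U'\to\tilde U$ over $U$, with $p'=h\circ p$, $I^h(V):I_p(V)\to I_{p'}(V)$ is induced by pre-composition with $h$. J2-structures. One has $I^{\omega}(\tilde U)\circ I_p(p)=I_{p_E}(p)\circ I^{\omega}(U):I_{p_E}(\tilde U)\to I_p(U)$, hence a morphism $coJ:I_{p_E}(\tilde U)\to Fp$ with components $I_{p_E}(p)$ and $I^{\omega}(\tilde U)$, where $Fp=(I_{p_E}(U),I^{\omega}(U))\times_{I_p(U)}(I_p(\tilde U),I_p(p))$. A J2-structure on $p$ relative to $(Eq,\Omega)$ is a morphism $Jp:Fp\to I_{p_E}(\tilde U)$ with $Jp\circ coJ=Id_{Fp}$ (such a morphism is automatically over $U$). *)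

(* Defs.v *)
From Stdlib Require Import ProofIrrelevance.
From mathcomp Require Import ssreflect ssrfun.

Set Implicit Arguments.
Unset Strict Implicit.
Unset Printing Implicit Defensive.

Declare Scope cat_scope.
Delimit Scope cat_scope with cat.
Local Open Scope cat_scope.

(* Composition is diagrammatic: [f \; g] is first [f], then [g].              *)
Record category := Category {
  ob :> Type;
  hom : ob -> ob -> Type;
  idm : forall X, hom X X;
  comp : forall X Y Z, hom X Y -> hom Y Z -> hom X Z;
  comp_idl : forall X Y (f : hom X Y), comp (idm X) f = f;
  comp_idr : forall X Y (f : hom X Y), comp f (idm Y) = f;
  compA : forall X Y Z W (f : hom X Y) (g : hom Y Z) (h : hom Z W),
    comp f (comp g h) = comp (comp f g) h }.

Arguments hom {c} X Y.
Arguments idm {c} X.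
Arguments comp {c X Y Z} f g.

Notation "f \; g" := (comp f g) : cat_scope.

(* A chosen pull-back of [f] and [g]; [pb_pair] is the mediating morphism.    *)
Record pullback (C : category) (X Y Z : C) (f : hom X Z) (g : hom Y Z) :=
  Pullback {
  pb_ob : C;
  pb_fst : hom pb_ob X;
  pb_snd : hom pb_ob Y;
  pb_comm : pb_fst \; f = pb_snd \; g;
  pb_pair : forall (W : C) (a : hom W X) (b : hom W Y),
    a \; f = b \; g -> hom W pb_ob;
  pb_pair_fst : forall W (a : hom W X) (b : hom W Y) (e : a \; f = b \; g),
    pb_pair e \; pb_fst = a;
  pb_pair_snd : forall W (a : hom W X) (b : hom W Y) (e : a \; f = b \; g),
    pb_pair e \; pb_snd = b;
  pb_ext : forall W (u v : hom W pb_ob),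
    u \; pb_fst = v \; pb_fst -> u \; pb_snd = v \; pb_snd -> u = v }.

Arguments pb_fst {C X Y Z f g} p.
Arguments pb_snd {C X Y Z f g} p.
Arguments pb_pair {C X Y Z f g} p {W a b} _.

(* [Slice f] is the pair (X, f), for [f : hom X Z].                           *)
Record slice (C : category) (Z : C) := Slice {
  sl_ob : C;
  sl_map : hom sl_ob Z }.

Coercion sl_ob : slice >-> ob.
Arguments Slice {C Z sl_ob} sl_map.
Arguments sl_map {C Z} s.

(* Hom_Z(A, B): the morphisms over Z.                                         *)
Record homover (C : category) (Z : C) (A B : slice Z) := Homover {
  ho_hom : hom A B;
  ho_over : ho_hom \; sl_map B = sl_map A }.

Coercion ho_hom : homover >-> hom.
Arguments Homover {C Z A B ho_hom} ho_over.

Section Over.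
Variables (C : category) (Z : C).
Implicit Types A B D : slice Z.

Lemma homover_eq A B (u v : homover A B) : (u : hom A B) = v -> u = v.
Proof.
case: u v => [u eu] [v ev] /= e; case: _ / e ev => ev.
by rewrite (proof_irrelevance _ eu ev).
Qed.

Definition id_over A : homover A A := Homover (comp_idl (sl_map A)).

Lemma comp_over_subproof A B D (u : homover A B) (v : homover B D) :
  (u \; v) \; sl_map D = sl_map A.
Proof. by rewrite -compA !ho_over. Qed.

Definition comp_over A B D (u : homover A B) (v : homover B D) : homover A D :=
  Homover (comp_over_subproof u v).

End Over.

Record fpcategory := FPCategory {
  fp_cat :> category;
  fp : forall (Z : fp_cat) (A B : slice Z), pullback (sl_map A) (sl_map B) }.

Arguments fp {f Z} A B.

Section FiberProduct.
Variables (C : fpcategory) (Z : C).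
Implicit Types A B : slice Z.

Definition fprod A B : slice Z := Slice (pb_fst (fp A B) \; sl_map A).

Lemma fprod_map_subproof A A' B B' (f : homover A A') (g : homover B B') :
  (pb_fst (fp A B) \; f) \; sl_map A' = (pb_snd (fp A B) \; g) \; sl_map B'.
Proof. by rewrite -!compA !ho_over pb_comm. Qed.

Definition fprod_hom A A' B B' (f : homover A A') (g : homover B B') :
    hom (fprod A B) (fprod A' B') :=
  pb_pair (fp A' B') (fprod_map_subproof f g).

Lemma fprod_hom_over A A' B B' (f : homover A A') (g : homover B B') :
  fprod_hom f g \; sl_map (fprod A' B') = sl_map (fprod A B).
Proof. by rewrite /= compA pb_pair_fst -compA ho_over. Qed.

Definition fprod_map A A' B B' (f : homover A A') (g : homover B B') :
    homover (fprod A B) (fprod A' B') :=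
  Homover (fprod_hom_over f g).

End FiberProduct.

(* [adj] is only required to be natural in [W]: the functoriality of [ihom]   *)
(* is not part of the data, it is defined below through [adj].                *)
Record lcccategory := LCCCategory {
  lccc_fp :> fpcategory;
  pt : lccc_fp;
  to_pt : forall X : lccc_fp, hom X pt;
  to_pt_uniq : forall (X : lccc_fp) (u v : hom X pt), u = v;
  ihom : forall (Z : lccc_fp) (A B : slice Z), slice Z;
  adj : forall (Z : lccc_fp) (W A B : slice Z),
    homover W (ihom A B) -> homover (fprod W A) B;
  adj_inv : forall (Z : lccc_fp) (W A B : slice Z),
    homover (fprod W A) B -> homover W (ihom A B);
  adjK : forall (Z : lccc_fp) (W A B : slice Z),
    cancel (@adj Z W A B) (@adj_inv Z W A B);
  adj_invK : forall (Z : lccc_fp) (W A B : slice Z),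
    cancel (@adj_inv Z W A B) (@adj Z W A B);
  adj_natural : forall (Z : lccc_fp) (W W' A B : slice Z)
      (k : homover W' W) (u : homover W (ihom A B)),
    adj (comp_over k u) = comp_over (fprod_map k (id_over A)) (adj u) }.

Arguments to_pt {l} X.
Arguments ihom {l Z} A B.
Arguments adj {l Z W A B} _.
Arguments adj_inv {l Z W A B} _.

Section LCCC.
Variable C : lcccategory.

Definition pt_slice (X : C) : slice (pt C) := Slice (to_pt X).

Definition pt_over (X Y : C) (f : hom X Y) :
    homover (pt_slice X) (pt_slice Y) :=
  @Homover C (pt C) (pt_slice X) (pt_slice Y) f (to_pt_uniq _ _).

Definition prod (X Y : C) : C := fprod (pt_slice X) (pt_slice Y).
Definition pr1 (X Y : C) : hom (prod X Y) X :=
  pb_fst (fp (pt_slice X) (pt_slice Y)).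
Definition pr2 (X Y : C) : hom (prod X Y) Y :=
  pb_snd (fp (pt_slice X) (pt_slice Y)).
Definition prod_map (X X' Y Y' : C) (f : hom X X') (g : hom Y Y') :
    hom (prod X Y) (prod X' Y') :=
  fprod_map (pt_over f) (pt_over g).

(* ev : Hom_Z(A, B) x_Z A -> B                                                *)
Definition ev (Z : C) (A B : slice Z) : homover (fprod (ihom A B) A) B :=
  adj (id_over (ihom A B)).

Definition ihom_post (Z : C) (A B B' : slice Z) (b : homover B B') :
    homover (ihom A B) (ihom A B') :=
  adj_inv (comp_over (ev A B) b).

Definition ihom_pre (Z : C) (A A' B : slice Z) (h : homover A' A) :
    homover (ihom A B) (ihom A' B) :=
  adj_inv (comp_over (fprod_map (id_over (ihom A B)) h) (ev A B)).

Lemma fprod_map_comp (Z : C) (A A' A'' B B' B'' : slice Z)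
    (f : homover A A') (f' : homover A' A'')
    (g : homover B B') (g' : homover B' B'') :
  comp_over (fprod_map f g) (fprod_map f' g') =
  fprod_map (comp_over f f') (comp_over g g').
Proof.
apply: homover_eq; apply: (pb_ext (p := fp A'' B'')); rewrite /= -compA.
- by rewrite !pb_pair_fst compA pb_pair_fst compA.
- by rewrite !pb_pair_snd compA pb_pair_snd compA.
Qed.

Lemma adjE (Z : C) (W A B : slice Z) (u : homover W (ihom A B)) :
  adj u = comp_over (fprod_map u (id_over A)) (ev A B).
Proof.
rewrite /ev -adj_natural; congr adj.
by apply: homover_eq; rewrite /= comp_idr.
Qed.

Lemma ihom_pre_post (Z : C) (A A' B B' : slice Z)
    (h : homover A' A) (b : homover B B') :
  ihom_pre B h \; ihom_post A' b = ihom_post A b \; ihom_pre B' h.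
Proof.
suff e : comp_over (ihom_pre B h) (ihom_post A' b) =
         comp_over (ihom_post A b) (ihom_pre B' h).
  exact: (congr1 (@ho_hom _ _ _ _) e).
apply: (can_inj (@adjK C Z _ _ _)).
have assoc (X Y V T : slice Z) (u : homover X Y) (v : homover Y V)
    (w : homover V T) : comp_over u (comp_over v w) =
                        comp_over (comp_over u v) w.
  by apply: homover_eq; rewrite /= compA.
have idl (X Y : slice Z) (u : homover X Y) : comp_over (id_over X) u = u.
  by apply: homover_eq; rewrite /= comp_idl.
have idr (X Y : slice Z) (u : homover X Y) : comp_over u (id_over Y) = u.
  by apply: homover_eq; rewrite /= comp_idr.
rewrite !adj_natural /ihom_post /ihom_pre !adj_invK !assoc -adjE adj_invK.
rewrite fprod_map_comp idr idl.
have -> : fprod_map (adj_inv (comp_over (ev A B) b)) h =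
  comp_over (fprod_map (id_over (ihom A B)) h)
            (fprod_map (adj_inv (comp_over (ev A B) b)) (id_over A)).
  by rewrite fprod_map_comp idl idr.
by rewrite -(assoc _ _ _ _ _ _ (ev A B')) -adjE adj_invK assoc.
Qed.

End LCCC.

Arguments pr1 {C} X Y.
Arguments pr2 {C} X Y.

(* The chosen square with vertex (X; F) has p_{X,F} = [pb_fst] and            *)
(* Q(F) = [pb_snd].                                                           *)
Record universe (C : category) := Universe {
  univ : C;
  univt : C;
  univ_map : hom univt univ;
  univ_pb : forall (X : C) (F : hom X univ), pullback F univ_map }.

Arguments univ {C} u.
Arguments univt {C} u.
Arguments univ_map {C} u.
Arguments univ_pb {C} u {X} F.

Section Universe.
Variables (C : category) (p : universe C).

(* (X; F), p_{X,F}, Q(F) and f * g                                            *)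
Definition ext (X : C) (F : hom X (univ p)) : C := pb_ob (univ_pb p F).
Definition extp (X : C) (F : hom X (univ p)) : hom (ext F) X :=
  pb_fst (univ_pb p F).
Definition extQ (X : C) (F : hom X (univ p)) : hom (ext F) (univt p) :=
  pb_snd (univ_pb p F).
Definition extpair (W X : C) (F : hom X (univ p)) (f : hom W X)
    (g : hom W (univt p)) (e : f \; F = g \; univ_map p) : hom W (ext F) :=
  pb_pair (univ_pb p F) e.

Definition J0_structure := hom (ext (univ_map p)) (univ p).

Definition Delta : hom (univt p) (ext (univ_map p)) :=
  extpair (erefl (idm (univt p) \; univ_map p)).

Section J0.
Variable Eq : J0_structure.

Definition EU : C := ext Eq.
Definition pE : hom EU (univ p) :=
  extp Eq \; extp (univ_map p) \; univ_map p.

Record J1_structure := J1Structure {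
  J1_map :> hom (univt p) (univt p);
  J1_axiom : J1_map \; univ_map p = Delta \; Eq }.

Definition omega (Omega : J1_structure) : hom (univt p) EU :=
  extpair (esym (J1_axiom Omega)).

Lemma omega_pE (Omega : J1_structure) : omega Omega \; pE = univ_map p.
Proof.
rewrite /pE /omega /extpair /extp !compA pb_pair_fst.
by rewrite /Delta /extpair pb_pair_fst comp_idl.
Qed.

Definition omega_over (Omega : J1_structure) :
    homover (Slice (univ_map p)) (Slice pE) :=
  @Homover _ _ (Slice (univ_map p)) (Slice pE) _ (omega_pE Omega).

End J0.
End Universe.

Arguments pE {C p} Eq.
Arguments omega {C p Eq} Omega.
Arguments omega_over {C p Eq} Omega.

Section I.
Variables (C : lcccategory) (Z : C).

Definition prod_slice (V : C) : slice Z := Slice (pr1 Z V).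

Lemma prod_slice_map_subproof (V V' : C) (a : hom V V') :
  prod_map (idm Z) a \; pr1 Z V' = pr1 Z V.
Proof. by rewrite /prod_map /= /fprod_hom /pr1 pb_pair_fst comp_idr. Qed.

Definition prod_slice_map (V V' : C) (a : hom V V') :
    homover (prod_slice V) (prod_slice V') :=
  @Homover _ _ (prod_slice V) (prod_slice V') _ (prod_slice_map_subproof a).

(* For [A] = (X, q): the object I_q(V) with its structure morphism prI_q(V),  *)
(* and the morphisms I_q(a) and I^h(V).                                       *)
Definition Iob (A : slice Z) (V : C) : slice Z := ihom A (prod_slice V).

Definition Imap (A : slice Z) (V V' : C) (a : hom V V') :
    homover (Iob A V) (Iob A V') :=
  ihom_post A (prod_slice_map a).

Definition Ipre (A A' : slice Z) (h : homover A' A) (V : C) :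
    homover (Iob A V) (Iob A' V) :=
  ihom_pre (prod_slice V) h.

End I.

Section J2.
Variables (C : lcccategory) (p : universe C) (Eq : J0_structure p).
Variable Omega : J1_structure Eq.

Local Notation U := (univ p).
Local Notation Ut := (univt p).
Local Notation Ip := (Iob (Slice (univ_map p))).
Local Notation IpE := (Iob (Slice (pE Eq))).
Local Notation Ip_p := (Imap (Slice (univ_map p)) (univ_map p)).
Local Notation IpE_p := (Imap (Slice (pE Eq)) (univ_map p)).
Local Notation Iomega := (Ipre (omega_over Omega)).

Definition Fp_pb := fp (Slice (Iomega U)) (Slice Ip_p).
Definition Fp : C := pb_ob Fp_pb.
Definition Fp_pr1 : hom Fp (IpE U) := pb_fst Fp_pb.
Definition Fp_pr2 : hom Fp (Ip Ut) := pb_snd Fp_pb.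

Lemma coJ_subproof : IpE_p \; Iomega U = Iomega Ut \; Ip_p.
Proof. by rewrite /Imap /Ipre ihom_pre_post. Qed.

Definition coJ : hom (IpE Ut) Fp := pb_pair Fp_pb coJ_subproof.

Definition pFp : hom Fp U := Fp_pr1 \; sl_map (IpE U).
Definition Fp_slice : slice U := Slice pFp.

Record J2_structure := J2Structure {
  J2_map :> hom Fp (IpE Ut);
  J2_axiom : J2_map \; coJ = idm Fp }.

Lemma J2_map_subproof (Jp : J2_structure) : Jp \; sl_map (IpE Ut) = pFp.
Proof.
rewrite -(ho_over IpE_p).
have -> : (IpE_p : hom (IpE Ut) (IpE U)) = coJ \; Fp_pr1.
  by rewrite /coJ /Fp_pr1 pb_pair_fst.
by rewrite !compA J2_axiom comp_idl.
Qed.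

Lemma Fp_pr2_subproof : Fp_pr2 \; sl_map (Ip Ut) = pFp.
Proof.
rewrite -(ho_over Ip_p) compA.
have /= <- := pb_comm Fp_pb.
by rewrite -compA ho_over.
Qed.

Definition J2_over (Jp : J2_structure) : homover Fp_slice (IpE Ut) :=
  @Homover _ _ Fp_slice (IpE Ut) _ (J2_map_subproof Jp).

Definition Fp_pr1_over : homover Fp_slice (IpE U) :=
  @Homover _ _ Fp_slice (IpE U) Fp_pr1 erefl.

Definition Fp_pr2_over : homover Fp_slice (Ip Ut) :=
  @Homover _ _ Fp_slice (Ip Ut) _ Fp_pr2_subproof.

(* (Fp, pFp) x_U (Ut, p) and (Fp, pFp) x_U (EU, p_E)                          *)
Definition FpUt : C := fprod Fp_slice (Slice (univ_map p)).
Definition FpEU : C := fprod Fp_slice (Slice (pE Eq)).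

Definition sq_top : hom FpUt Ut := adj Fp_pr2_over \; pr2 U Ut.
Definition sq_bottom : hom FpEU U := adj Fp_pr1_over \; pr2 U U.
Definition sq_left : hom FpUt FpEU :=
  fprod_map (id_over Fp_slice) (omega_over Omega).

Definition J2_rule (Jp : J2_structure) : hom FpEU Ut :=
  adj (J2_over Jp) \; pr2 U Ut.

End J2.

Arguments sq_top {C p Eq} Omega.
Arguments sq_bottom {C p Eq} Omega.
Arguments sq_left {C p Eq} Omega.
Arguments FpEU {C p Eq} Omega.

Definition splits (C : category) (A B X Y : C) (top : hom A X) (left : hom A B)
    (right : hom X Y) (bottom : hom B Y) (g : hom B X) : Prop :=
  left \; g = top /\ g \; right = bottom.

(* Main.v *)
Require Import Defs.
From Stdlib Require Import ProofIrrelevance.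
From mathcomp Require Import ssreflect ssrfun.

(** The object [Iob A V] represents, among slices [W] over [Z], the plain
    morphisms [fprod W A -> V]: by [adj] a morphism [W -> Iob A V] over [Z] is a
    morphism [fprod W A -> Z x V] over [Z], and the first component of the
    latter is forced, so that only its component in [V] ([transpose]) carries
    information.  Under this bijection ([transposeK], [untransposeK])
    post-composition with [Imap a] becomes post-composition with [a]
    ([transpose_Imap]) and post-composition with [Ipre h] becomes
    pre-composition with [Id x h] ([transpose_Ipre]).

    A section of [coJ] is a morphism [J] from [Fp] to [I_{p_E}(Ut)],
    automatically over [U], whose composites with [I_{p_E}(p)] and
    [I^omega(Ut)] are the two projections of [Fp].  Transposing these two equations turns them into the
    commutativity of the lower and of the upper triangle for [transpose J]
    ([section_coJ_iff_splits]); the rule of the theorem is the restriction of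
    the bijection [transpose] to the two sides of this equivalence. *)

Set Implicit Arguments.
Unset Strict Implicit.
Unset Printing Implicit Defensive.

Local Open Scope cat_scope.

(** * Transposition of morphisms into internal Hom-objects *)

Section Transpose.
Variables (C : lcccategory) (Z : C).
Implicit Types W A B : slice Z.

Lemma adj_post W A B B' (u : homover W (ihom A B)) (b : homover B B') :
  adj (comp_over u (ihom_post A b)) = comp_over (adj u) b.
Proof.
rewrite adj_natural /ihom_post adj_invK (adjE u).
by apply: homover_eq; rewrite /= Defs.compA.
Qed.

(** Both sides evaluate [u] at [h]: the exchange law for [fprod_map] lets [u]
    and [h] act one after the other in either order. *)
Lemma adj_pre W A A' B (u : homover W (ihom A B)) (h : homover A' A) :
  adj (comp_over u (ihom_pre B h)) =
  comp_over (fprod_map (id_over W) h) (adj u).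
Proof.
rewrite adj_natural /ihom_pre adj_invK (adjE u).
have e : comp_over (fprod_map u (id_over A')) (fprod_map (id_over _) h) =
         comp_over (fprod_map (id_over W) h) (fprod_map u (id_over A)).
  rewrite !fprod_map_comp; congr fprod_map; apply: homover_eq => /=;
  by rewrite comp_idl comp_idr.
apply: homover_eq; rewrite /= !Defs.compA; congr (_ \; _).
exact: (congr1 (@ho_hom _ _ _ _) e).
Qed.

Definition transpose W A V (u : homover W (Iob A V)) : hom (fprod W A) V :=
  adj u \; pr2 Z V.

Definition over_prod B V (g : hom B V) : homover B (prod_slice Z V) :=
  @Homover _ _ B (prod_slice Z V)
    (pb_pair (fp (pt_slice Z) (pt_slice V))
       (to_pt_uniq (sl_map B \; to_pt Z) (g \; to_pt V)))
    (pb_pair_fst _ _).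

Definition untranspose W A V (g : hom (fprod W A) V) : homover W (Iob A V) :=
  adj_inv (over_prod g).

Lemma untransposeK W A V : cancel (@untranspose W A V) (@transpose W A V).
Proof. by move=> g; rewrite /transpose /untranspose adj_invK /= pb_pair_snd. Qed.

Lemma transposeK W A V : cancel (@transpose W A V) (@untranspose W A V).
Proof.
move=> u; apply: (can_inj (@adjK C Z _ _ _)); rewrite adj_invK.
apply: homover_eq; apply: (pb_ext (p := fp (pt_slice Z) (pt_slice V))) => /=.
- by rewrite pb_pair_fst; exact: (esym (ho_over (adj u))).
- by rewrite pb_pair_snd.
Qed.

Lemma transpose_Imap W A V V' (u : homover W (Iob A V)) (a : hom V V') :
  transpose (comp_over u (Imap A a)) = transpose u \; a.
Proof.
rewrite /transpose /Imap adj_post /= -Defs.compA -[in RHS]Defs.compA; congr (_ \; _).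
by rewrite /prod_map /= /fprod_hom pb_pair_snd.
Qed.

Lemma transpose_Ipre W A A' V (u : homover W (Iob A V)) (h : homover A' A) :
  transpose (comp_over u (Ipre h V)) =
  fprod_map (id_over W) h \; transpose u.
Proof. by rewrite /transpose /Ipre adj_pre /= Defs.compA. Qed.

End Transpose.

(** * Sections of [coJ] and diagonal fillers of the square *)

Section J2.
Variables (C : lcccategory) (p : universe C) (Eq : J0_structure p).
Variable Omega : J1_structure Eq.

Local Notation IpEUt := (Iob (Slice (pE Eq)) (univt p)).
Local Notation filler :=
  (splits (sq_top Omega) (sq_left Omega) (univ_map p) (sq_bottom Omega)).

(** [sq_bottom] and [sq_top] are by definition the transposes of the two
    projections of [Fp], so by naturality and injectivity of [transpose] the
    triangles say that [J \; coJ] and the identity have the same components in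
    the fibre product [Fp]. *)
Lemma section_coJ_iff_splits (J : homover (Fp_slice Omega) IpEUt) :
  J \; coJ Omega = idm (Fp Omega) <-> filler (transpose J).
Proof.
rewrite /splits /sq_left -transpose_Ipre -transpose_Imap.
rewrite -/(transpose (Fp_pr1_over Omega)) -/(transpose (Fp_pr2_over Omega)).
split=> [JK | [/(can_inj (@transposeK _ _ _ _ _)) e2
               /(can_inj (@transposeK _ _ _ _ _)) e1]].
- split; congr transpose; apply: homover_eq => /=.
  + rewrite -(pb_pair_snd (Fp_pb Omega) (coJ_subproof Omega)).
    by rewrite Defs.compA (JK : J \; pb_pair _ _ = _) comp_idl.
  + rewrite -(pb_pair_fst (Fp_pb Omega) (coJ_subproof Omega)).
    by rewrite Defs.compA (JK : J \; pb_pair _ _ = _) comp_idl.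
- apply: (pb_ext (p := Fp_pb Omega)); rewrite comp_idl -Defs.compA.
  + rewrite pb_pair_fst; exact: (congr1 (@ho_hom _ _ _ _) e1).
  + rewrite pb_pair_snd; exact: (congr1 (@ho_hom _ _ _ _) e2).
Qed.

Lemma J2_structure_eq (J J' : J2_structure Omega) :
  (J : hom _ _) = J' -> J = J'.
Proof.
case: J J' => [J JK] [J' J'K] /= e; case: _ / e J'K => J'K.
by rewrite (proof_irrelevance _ JK J'K).
Qed.

Definition filler_of_J2 (J : J2_structure Omega) : {g | filler g} :=
  exist _ (J2_rule J)
    (proj1 (section_coJ_iff_splits (J2_over J)) (J2_axiom J)).

Lemma untranspose_section (g : hom (FpEU Omega) (univt p)) :
  filler g -> untranspose g \; coJ Omega = idm (Fp Omega).
Proof. by move=> gP; apply/section_coJ_iff_splits; rewrite untransposeK. Qed.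

Definition J2_of_filler (g : {g | filler g}) : J2_structure Omega :=
  J2Structure (untranspose_section (proj2_sig g)).

Lemma filler_of_J2K : cancel filler_of_J2 J2_of_filler.
Proof.
move=> J; apply: J2_structure_eq.
exact: (congr1 (@ho_hom _ _ _ _) (transposeK (J2_over J))).
Qed.

Lemma J2_of_fillerK : cancel J2_of_filler filler_of_J2.
Proof.
case=> g gP; apply: eq_sig_hprop => [? ? ? | /=]; first exact: proof_irrelevance.
rewrite -[RHS](untransposeK g); congr transpose.
exact: homover_eq.
Qed.

End J2.

Theorem mainTheorem1 (C : lcccategory) (p : universe C) (Eq : J0_structure p)
    (Omega : J1_structure Eq) :
  exists f : J2_structure Omega ->
      {g : hom (FpEU Omega) (univt p) |
        splits (sq_top Omega) (sq_left Omega) (univ_map p) (sq_bottom Omega) g},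
    (forall Jp : J2_structure Omega, proj1_sig (f Jp) = J2_rule Jp) /\
    bijective f.
Proof.
exists (@filler_of_J2 C p Eq Omega); split=> //.
by exists (@J2_of_filler C p Eq Omega);
  [exact: filler_of_J2K | exact: J2_of_fillerK].
Qed.
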